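(* Every Ptolemaic graph is a BDM graph.
   Context: All graphs are undirected, simple, finite and connected; a graph of order $n$ has vertex set $[n]=\{1,\ldots,n\}$ unless otherwise specified. $d_G(u,v)$ denotes the distance between $u$ and $v$ in $G$, and $N(v)$ denotes the open neighborhood of $v$. A graph is distance-hereditary if every induced path is isometric (i.e. distances along the path equal distances in the graph). A graph is chordal if it has no induced cycle of length at least four. A graph is Ptolemaic if it is both distance-hereditary and chordal. A vertex $v$ is a boundary vertex of a vertex $u$ if $d_G(u,w)\le d_G(u,v)$ for every $w\in N(v)$; $\partial(u)$ is the set of boundary vertices of $u$, and the boundary of $G$ is $\partial(G)=\bigcup_{u\in V(G)}\partial(u)$. The boundary distance matrix $\hat{D}_G$ is the square matrix indexed by $\partial(G)$ with entries $[\hat{D}_G]_{ij}=d_G(i,j)$ for $i,j\in\partial(G)$. A graph $G$ of order $n$ is called a BDM graph (boundary-distance-matrix constructible) if it is uniquely determined by $\hat{D}_G$, provided that both $n$ and $\partial(G)$ are prescribed; that is, every connected graph $G'$ on the vertex set $V(G)$ with $\partial(G')=\partial(G)$ and $\hat{D}_{G'}=\hat{D}_G$ is isomorphic to $G$. *)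

(* Defs.v *)
From mathcomp Require Import all_boot matrix.
Set Implicit Arguments.
Unset Strict Implicit.
Unset Printing Implicit Defensive.

Record sgraph (T : finType) := SGraph {
  adj :> rel T;
  adj_sym : symmetric adj;
  adj_irrefl : irreflexive adj
}.

Section Graphs.
Variable T : finType.
Implicit Types (G H : sgraph T) (u v w : T).

Definition connected_graph G : Prop := forall u v, connect G u v.

Definition graph_iso G H : Prop :=
  exists2 f : T -> T, bijective f & forall u v, H (f u) (f v) = G u v.

Definition walk G (k : nat) u v : bool :=
  [exists p : k.-tuple T, path G u p && (last u p == v)].

(* The least length of a walk from u to v; a shortest walk has length less
   than #|T|.  When no walk exists, [find] returns the junk value #|T|. *)
Definition dist G u v : nat := find (fun k => walk G k u v) (iota 0 #|T|).

Definition induced_path G k (p : 'I_k -> T) : Prop :=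
  injective p /\
  forall i j : 'I_k, G (p i) (p j) = (i.+1 == j :> nat) || (j.+1 == i :> nat).

Definition isometric_path G k (p : 'I_k -> T) : Prop :=
  forall i j : 'I_k, i <= j -> dist G (p i) (p j) = j - i.

Definition distance_hereditary G : Prop :=
  forall k (p : 'I_k -> T), induced_path G p -> isometric_path G p.

(* Meaningful as "induced cycle of length k" for 3 <= k only. *)
Definition induced_cycle G k (c : 'I_k -> T) : Prop :=
  injective c /\
  forall i j : 'I_k,
    G (c i) (c j) = (i.+1 %% k == j :> nat) || (j.+1 %% k == i :> nat).

Definition chordal G : Prop :=
  forall k (c : 'I_k -> T), 4 <= k -> ~ induced_cycle G c.

Definition ptolemaic G : Prop := distance_hereditary G /\ chordal G.

Definition boundary_of G u : {set T} :=
  [set v | [forall w, G v w ==> (dist G u w <= dist G u v)]].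

Definition boundary G : {set T} := \bigcup_(u : T) boundary_of G u.

(* Rows and columns follow the canonical enumeration of the set [boundary G],
   which depends on that set only, not on G. *)
Definition boundary_dist_matrix G : 'M[nat]_#|boundary G| :=
  \matrix_(i, j) dist G (enum_val i) (enum_val j).

Lemma card_boundary_eq G H : boundary H = boundary G ->
  #|boundary H| = #|boundary G|.
Proof. by move->. Qed.

(* The cast only transports the index type along boundary H = boundary G, so
   the equation compares the entries at the same pairs of vertices. *)
Definition BDM_graph G : Prop :=
  forall (H : sgraph T) (eqB : boundary H = boundary G),
    connected_graph H ->
    castmx (card_boundary_eq eqB, card_boundary_eq eqB)
      (boundary_dist_matrix H) = boundary_dist_matrix G ->
    graph_iso G H.

End Graphs.

(* Main.v *)
Require Import Defs.
From mathcomp Require Import all_boot.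
From mathcomp Require Import matrix zify.

Set Implicit Arguments.
Unset Strict Implicit.
Unset Printing Implicit Defensive.

(** The proof rests on two facts: in every connected graph the boundary
    determines all distances, and Ptolemaic graphs have the Helly property for
    balls.

    The first: a geodesic from u to v that is prolonged beyond v as far as
    possible ends at a boundary vertex x, so d(u,x) = d(u,v) + d(v,x)
    ([extend_to_boundary]).  Hence d(u,v) is the maximum over the boundary of
    |d(u,x) - d(v,x)|, and the function f = d(v,_) on the boundary is
    pointwise minimal among those with f(x) + f(y) >= d(x,y), because each x
    has a boundary vertex y for which equality holds.

    The second ([ptolemaic_helly]): in a Ptolemaic graph, every f on a set B
    with f(x) + f(y) >= d(x,y) on B admits a vertex u with d(u,x) <= f(x)
    for all x in B.

    Let H be another graph with the boundary B and the boundary distances of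
    G.  For a vertex v of H the function d_H(v,_) on B satisfies the Helly
    hypothesis in G; this yields a vertex phi(v), and minimality turns the
    inequalities into d_G(phi(v),x) = d_H(v,x).  As distances are maxima of
    differences over B in both graphs, phi is isometric, hence injective,
    hence a bijection of the common vertex set and an isomorphism.

    The Helly property follows from a single metric consequence of being
    Ptolemaic ([dist_turn]): if u and w are neighbors of v that start geodesics
    to x and to y, and u and w are distinct and not adjacent, then
    d(x,y) = d(v,x) + d(v,y).  A vertex v that violates the constraints by at
    most k+1 is then moved to a neighbor violating them by at most k.  For x
    in the set of worst constraints, let C(x) be the neighbors of v closer
    to x.  These sets meet pairwise ([toward_meet]) and meeting ones are nested
    ([toward_nested]), so a smallest C(x) lies in all of them; any of its
    elements improves every worst constraint, and [toward_dist_le] shows that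
    it spoils no other one. *)

(** * Distances and geodesics *)

Section Distance.
Variables (T : finType) (G : sgraph T).
Implicit Types (u v w x y : T) (p : seq T).

Lemma walkP k u v :
  reflect (exists p, [/\ size p = k, path G u p & last u p = v]) (walk G k u v).
Proof.
apply: (iffP existsP) => [[p /andP[pathp /eqP lastp]]|[p [sizep pathp lastp]]].
  by exists p; rewrite size_tuple.
have sp : size p == k by apply/eqP.
by exists (Tuple sp); rewrite /= pathp lastp eqxx.
Qed.

Lemma dist_le_card u v : dist G u v <= #|T|.
Proof. by rewrite /dist -{2}(size_iota 0 #|T|) find_size. Qed.

Lemma dist_le_walk k u v : walk G k u v -> dist G u v <= k.
Proof.
move=> walk_uv; have [|ltkT] := leqP #|T| k.
  exact/leq_trans/dist_le_card.
rewrite leqNgt; apply/negP => /(before_find 0).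
by rewrite nth_iota // add0n walk_uv.
Qed.

Hypothesis connG : connected_graph G.

Lemma walk_dist u v : walk G (dist G u v) u v.
Proof.
have /connectP[p pathp lastp] := connG u v.
case/shortenP: pathp lastp => q pathq uniqq _ lastq.
have ltqT : size q < #|T|.
  by have := max_card (mem (u :: q)); rewrite (card_uniqP uniqq).
have hasw : has (fun k => walk G k u v) (iota 0 #|T|).
  apply/hasP; exists (size q); first by rewrite mem_iota.
  by apply/walkP; exists q.
have := nth_find 0 hasw; rewrite nth_iota ?add0n //.
by rewrite has_find size_iota in hasw.
Qed.

Lemma distxx v : dist G v v = 0.
Proof. by apply/eqP; rewrite -leqn0; apply/dist_le_walk/walkP; exists [::]. Qed.

Lemma dist_eq0 u v : (dist G u v == 0) = (u == v).
Proof.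
apply/eqP/eqP => [d0|->]; last exact: distxx.
by have /walkP[p] := walk_dist u v; rewrite d0 => -[/size0nil -> _ /=].
Qed.

Lemma dist_triangle v u w : dist G u w <= dist G u v + dist G v w.
Proof.
have /walkP[p [sp pp lp]] := walk_dist u v.
have /walkP[q [sq pq lq]] := walk_dist v w.
apply/dist_le_walk/walkP; exists (p ++ q).
by rewrite size_cat cat_path last_cat lp sp sq pp pq.
Qed.

Lemma dist_sym u v : dist G u v = dist G v u.
Proof.
wlog suff leuv : u v / dist G u v <= dist G v u.
  by apply/eqP; rewrite eqn_leq !leuv.
have /walkP[p [sp pp lp]] := walk_dist v u.
apply/dist_le_walk/walkP; exists (rev (belast v p)).
rewrite size_rev size_belast; split=> //.
- rewrite -[X in path _ X]lp rev_path (eq_path (e' := G)) // => a b.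
  by rewrite adj_sym.
- by case: p {sp pp} lp => //= a p; rewrite rev_cons last_rcons.
Qed.

Lemma dist_adj u v : (dist G u v == 1) = G u v.
Proof.
apply/eqP/idP => [d1|Guv].
  have /walkP[p] := walk_dist u v; rewrite d1.
  by case: p => [|a [|b p]] [] //= _ /andP[Gua _] <-.
apply/eqP; rewrite eqn_leq lt0n dist_eq0; apply/andP; split.
  by apply/dist_le_walk/walkP; exists [:: v]; rewrite /= Guv.
by apply/eqP => uv; rewrite uv adj_irrefl in Guv.
Qed.

Lemma dist_adj_le u v x : G u v -> dist G u x <= (dist G v x).+1.
Proof. by rewrite -dist_adj => /eqP; have := dist_triangle v u x; lia. Qed.

Lemma dist_step v x : 0 < dist G v x ->
  exists2 u, G v u & (dist G u x).+1 = dist G v x.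
Proof.
have /walkP[[|u p] [/= sizep pathp lastp]] := walk_dist v x.
  by rewrite -sizep.
case/andP: pathp => Gvu pathp _; exists u => //.
have := dist_adj_le x Gvu.
have : dist G u x <= size p by apply/dist_le_walk/walkP; exists p.
lia.
Qed.

(** Functions on nat instead of sequences let two geodesics from a common
    vertex be glued by arithmetic on indices. *)
Lemma geodesic_through v u x : G v u -> (dist G u x).+1 = dist G v x ->
  exists P : nat -> T, [/\ P 0 = v, P 1 = u, P (dist G v x) = x &
    forall i j, i <= j <= dist G v x -> dist G (P i) (P j) = j - i].
Proof.
move=> Gvu; set a := dist G v x => dux.
have /walkP[p [sp pp lp]] := walk_dist u x.
have sa : size (u :: p) = a by rewrite /= sp.
have pathvp : path G v (u :: p) by rewrite /= Gvu.
pose P := nth x (v :: u :: p).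
have Pa : P a = x by rewrite /P -sa -[size _]/(size (v :: u :: p)).-1 nth_last.
have short i j : i <= j <= a -> dist G (P i) (P j) <= j - i.
  elim: j => [|j IHj] leija.
    have -> : i = 0 by lia.
    by rewrite distxx.
  have [->|neij] := eqVneq i j.+1; first by rewrite distxx.
  have := IHj ltac:(lia).
  have : dist G (P j) (P j.+1) <= 1.
    rewrite leq_eqVlt dist_adj; apply/orP; left.
    by apply: (pathP x pathvp); lia.
  have := dist_triangle (P j) (P i) (P j.+1); lia.
exists P; split=> // i j leija.
have := short i j leija.
have := short 0 i ltac:(lia); have := short j a ltac:(lia).
have := dist_triangle (P i) (P 0) (P a).
have := dist_triangle (P j) (P i) (P a).
by rewrite Pa -[dist G (P 0) x]/a; lia.
Qed.
End Distance.

(** * Turning geodesics in Ptolemaic graphs *)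

Definition apart (T : finType) (G : sgraph T) u v := (u != v) && ~~ G u v.

Section Turn.
Variables (T : finType) (G : sgraph T) (P Q : nat -> T) (a b : nat).
Hypothesis connG : connected_graph G.
Hypothesis geoP : forall i j, i <= j <= a -> dist G (P i) (P j) = j - i.
Hypothesis geoQ : forall i j, i <= j <= b -> dist G (Q i) (Q j) = j - i.
Hypothesis eqPQ0 : P 0 = Q 0.

(** The walk from [P i] back to [P 0 = Q 0] and on along [Q]. *)
Definition turn i t := if t <= i then P (i - t) else Q (t - i).

Lemma turn_adj i s t : i <= a -> s < t <= i + b ->
    (s < i < t -> apart G (P (i - s)) (Q (t - i))) ->
  (turn i s != turn i t) && (G (turn i s) (turn i t) == (s.+1 == t)).
Proof.
move=> leia ltst sep; rewrite /turn -(dist_eq0 connG) -(dist_adj connG).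
case: (leqP t i) => leti.
  have -> : s <= i by lia.
  by rewrite (dist_sym connG) geoP; lia.
case: (leqP s i) => lesi; last by rewrite geoQ; lia.
have [->|ltsi] := eqVneq s i.
  by rewrite subnn eqPQ0 geoQ; lia.
have := sep ltac:(lia).
by rewrite /apart -(dist_eq0 connG) -(dist_adj connG); lia.
Qed.

Hypothesis ptolG : ptolemaic G.

(** A contact between [P i] and [Q j] with i + j minimal closes the part of the
    two geodesics before it into an induced cycle of length i + j + 1 >= 4. *)
Lemma turn_apart i j : apart G (P 1) (Q 1) -> 0 < i <= a -> 0 < j <= b ->
  apart G (P i) (Q j).
Proof.
move=> apart1; have [m] := ubnP (i + j).
elim: m => // m IHm in i j * => ltijm lei lej.
have [eq2|ne2] := eqVneq (i + j) 2.
  have -> : i = 1 by lia.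
  by have -> : j = 1 by lia.
have neqPQ : P i != Q j.
  apply/eqP => eqPQ.
  have eqij : i = j.
    have := geoP (i := 0) (j := i) ltac:(lia).
    by rewrite eqPQ0 eqPQ geoQ; lia.
  have /andP[_] := IHm i j.-1 ltac:(lia) ltac:(lia) ltac:(lia).
  by rewrite eqPQ -(dist_adj connG) (dist_sym connG) geoQ; lia.
rewrite /apart neqPQ /=; apply/negP => GPQ.
(* For s < t, only the pair of end vertices wraps around modulo i + j + 1. *)
have adjlt (s t : 'I_(i + j).+1) : s < t ->
  (turn i s != turn i t) &&
  (G (turn i s) (turn i t) ==
    ((s.+1 %% (i + j).+1 == t) || (t.+1 %% (i + j).+1 == s))).
  move=> ltst; have := ltn_ord t; rewrite ltnS => let_.
  have [/andP[/eqP s0 /eqP tij]|ends] :=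
    boolP ((s == 0 :> nat) && (t == i + j :> nat)).
    rewrite s0 tij modnn orbT /turn leq0n subn0 addKn.
    have -> : (i + j <= i) = false by lia.
    by rewrite neqPQ GPQ.
  have := @turn_adj i s t ltac:(lia) ltac:(lia).
  move=> /(_ (fun lt => IHm (i - s) (t - i) ltac:(lia) ltac:(lia) ltac:(lia))).
  rewrite [s.+1 %% _]modn_small; last by lia.
  have [eqt|net] := eqVneq (t : nat) (i + j); last by rewrite modn_small; lia.
  by rewrite [t.+1]/= eqt modnn; lia.
apply: (ptolG.2 (i + j).+1 (fun t => turn i t)); first lia.
split=> [s t /eqP eqst|s t].
  apply: val_inj => /=; move: eqst; apply: contraTeq; rewrite neq_ltn.
  by case/orP=> /adjlt /andP[]; rewrite // eq_sym.
have [/adjlt /andP[_ /eqP]//|/adjlt /andP[_ /eqP]|eqst] := ltngtP s t.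
  by rewrite adj_sym orbC.
have -> : s = t by apply: val_inj.
rewrite adj_irrefl orbb; apply/esym/negbTE.
have := ltn_ord t; rewrite ltnS leq_eqVlt => /orP[/eqP ->|ltt].
  by rewrite modnn; lia.
by rewrite modn_small; lia.
Qed.

(** Without contacts the glued walk is an induced path, hence isometric. *)
Lemma turn_dist : 0 < a -> 0 < b -> apart G (P 1) (Q 1) ->
  dist G (P a) (Q b) = a + b.
Proof.
move=> a_gt0 b_gt0 apart1.
have adjlt (s t : 'I_(a + b).+1) : s < t ->
    (turn a s != turn a t) && (G (turn a s) (turn a t) == (s.+1 == t)).
  move=> ltst; have := ltn_ord t; rewrite ltnS => let_.
  apply: turn_adj; [lia | lia | move=> lt; apply: turn_apart => //; lia].
have indP : induced_path G (fun t : 'I_(a + b).+1 => turn a t).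
  split=> [s t /eqP eqst|s t].
    apply: val_inj => /=; move: eqst; apply: contraTeq; rewrite neq_ltn.
    by case/orP=> /adjlt /andP[]; rewrite // eq_sym.
  have [lt|lt|eqst] := ltngtP s t.
  - by have /andP[_ /eqP ->] := adjlt s t lt; lia.
  - by rewrite adj_sym; have /andP[_ /eqP ->] := adjlt t s lt; lia.
  - have -> : s = t by apply: val_inj.
    by rewrite adj_irrefl; lia.
have := ptolG.1 _ _ indP ord0 ord_max ltac:(by []).
by rewrite /turn /= !subn0 addKn (_ : (a + b <= a) = false) //; lia.
Qed.
End Turn.

(** * The Helly property of Ptolemaic graphs *)

Section Ptolemaic.
Variables (T : finType) (G : sgraph T).
Hypothesis connG : connected_graph G.
Hypothesis ptolG : ptolemaic G.
Implicit Types u v w x y : T.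

Definition toward v x u := G v u && ((dist G u x).+1 == dist G v x).

Lemma dist_turn v u w x y : toward v x u -> toward v y w -> apart G u w ->
  dist G x y = dist G v x + dist G v y.
Proof.
move=> /andP[Gvu /eqP dux] /andP[Gvw /eqP dwy] uw.
have [P [P0 P1 Px geoP]] := geodesic_through connG Gvu dux.
have [Q [Q0 Q1 Qy geoQ]] := geodesic_through connG Gvw dwy.
rewrite -[in LHS]Px -[in LHS]Qy.
by rewrite (turn_dist connG geoP geoQ) ?P0 ?P1 ?Q1 //; lia.
Qed.

Lemma exists_toward v x : 0 < dist G v x -> exists u, toward v x u.
Proof.
by case/(dist_step connG) => u Gvu /eqP dux; exists u; rewrite /toward Gvu.
Qed.

(** Two nonadjacent first steps toward x would put x at distance 2 d(v,x) from
    itself. *)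
Lemma toward_clique v x u w : toward v x u -> toward v x w -> u != w -> G u w.
Proof.
move=> tu tw neq; apply: contraLR tu => nuw; apply/negP => tu.
have := dist_turn tu tw; rewrite /apart neq nuw distxx => /(_ isT).
by case/andP: tu; lia.
Qed.

(** The triangle condition.  If a first step w from v toward x were not adjacent
    to u, the turn at v would give d(u,x) = 1 + d(v,x). *)
Lemma common_toward u v x :
    G u v -> dist G u x = dist G v x -> 0 < dist G v x ->
  exists2 w, toward u x w & toward v x w.
Proof.
move=> Guv eqd gt0.
have Gvu : G v u by rewrite adj_sym.
have [w tw] := exists_toward gt0; exists w => //.
have /andP[Gvw /eqP dw] := tw; rewrite /toward eqd dw eqxx andbT.
apply: contraTT (Gvu) => nuw.
have tu : toward v u u by rewrite /toward Gvu distxx eq_sym (dist_adj connG).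
have := dist_turn tu tw; rewrite /apart nuw andbT.
have -> : u != w by apply/eqP => uw; rewrite uw in eqd; lia.
by move=> /(_ isT); rewrite eqd -(dist_adj connG); lia.
Qed.

(** A first step w toward y equals u or is adjacent to it, since v is not on a
    geodesic from x to y. *)
Lemma toward_dist_le v u x y : toward v x u ->
  dist G x y < dist G v x + dist G v y -> dist G u y <= dist G v y.
Proof.
move=> tu lt; have [y0|gt0] := posnP (dist G v y).
  move/eqP: y0 lt; rewrite dist_eq0 // => /eqP <-.
  by rewrite distxx (dist_sym connG); lia.
have [w tw] := exists_toward gt0.
have [eqv|neq] := eqVneq u w.
  by case/andP: tw; rewrite eqv; lia.
have [Guw|nGuw] := boolP (G u w).
  by have := dist_adj_le connG y Guw; case/andP: tw; lia.
by have := dist_turn tu tw; rewrite /apart neq nGuw => /(_ isT); lia.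
Qed.

(** A step u toward x that is not also one toward y stays level with v relative
    to y.  The common neighbor w of u and v given by the triangle condition is
    closer to y, and it is not farther from x than u, by [toward_dist_le]
    applied to the step from u to w. *)
Lemma toward_meet v x y : dist G x y + 2 <= dist G v x + dist G v y ->
  exists2 u, toward v x u & toward v y u.
Proof.
move=> le2.
have y_gt0 : 0 < dist G v y.
  have := dist_triangle connG y v x.
  by rewrite [dist G y x](dist_sym connG); lia.
have x_gt0 : 0 < dist G v x by have := dist_triangle connG x v y; lia.
have [u tu] := exists_toward x_gt0; have /andP[Gvu /eqP dux] := tu.
have leuy := toward_dist_le (y := y) tu ltac:(lia).
have [lt|eqd] : dist G u y < dist G v y \/ dist G u y = dist G v y by lia.
  exists u => //; rewrite /toward Gvu.
  by have := dist_adj_le connG y Gvu; lia.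
have Guv : G u v by rewrite adj_sym.
have [w tuw tvw] := common_toward Guv eqd y_gt0; exists w => //.
have /andP[Gvw _] := tvw.
have lewx : dist G w x <= dist G u x.
  by apply: (toward_dist_le tuw); rewrite (dist_sym connG); lia.
by rewrite /toward Gvw; have := dist_adj_le connG x Gvw; lia.
Qed.

Lemma P4_dist a b c d : G a b -> G b c -> G c d ->
  apart G a c -> apart G b d -> dist G a d = 3.
Proof.
move=> Gab Gbc Gcd ac bd; have Gba : G b a by rewrite adj_sym.
have dba : dist G b a = 1 by apply/eqP; rewrite dist_adj.
have dcd : dist G c d = 1 by apply/eqP; rewrite dist_adj.
have dbc : dist G b c = 1 by apply/eqP; rewrite dist_adj.
have dbd : dist G b d = 2.
  have := dist_triangle connG c b d.
  by move: bd; rewrite /apart -(dist_eq0 connG) -(dist_adj connG); lia.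
have ta : toward b a a by rewrite /toward Gba distxx dba.
have tc : toward b d c by rewrite /toward Gbc dcd dbd.
by rewrite (dist_turn ta tc ac); lia.
Qed.

(** The vertex p bounds d(a,d) by 2, while the path forces it to be 3.  This
    covers gems, where a and d are not adjacent, as well as induced 4-cycles
    with p over the edge from a to d. *)
Lemma gem_free p a b c d : G a b -> G b c -> G c d ->
  apart G a c -> apart G b d -> G p a -> G p d -> False.
Proof.
move=> Gab Gbc Gcd ac bd Gpa Gpd; have := P4_dist Gab Gbc Gcd ac bd.
have := dist_triangle connG p a d; rewrite (dist_sym connG a p).
by move: Gpa Gpd; rewrite -!(dist_adj connG); lia.
Qed.

Lemma dist_apart u w x : (dist G u x).+1 < dist G w x -> apart G u w.
Proof.
move=> lt; rewrite /apart -(dist_eq0 connG) -(dist_adj connG).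
by have := dist_triangle connG u w x; rewrite [dist G w u](dist_sym connG); lia.
Qed.

Lemma apart_sym u w : apart G u w = apart G w u.
Proof. by rewrite /apart eq_sym adj_sym. Qed.

(** If a is closer only to x, b only to y, and p to both, let c and e be common
    neighbors of p with a and with b, one layer closer to x and to y.  Then
    [gem_free] excludes p over the path c, a, b, e if a and b are adjacent, and
    over c, a, v, b otherwise. *)
Lemma toward_nested v x y p a b :
  toward v x p -> toward v y p -> toward v x a -> toward v y b ->
  toward v y a || toward v x b.
Proof.
move=> xp yp xa yb; apply/norP=> -[nya nxb].
have step z q r : toward v z p -> toward v z q -> ~~ toward v z r -> G v r ->
    p != q -> exists c, [/\ G p c, G q c, apart G c v & apart G c r].
  move=> zp zq nzr Gvr npq; have Gpq := toward_clique zp zq npq.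
  have /andP[Gvp /eqP dp] := zp; have /andP[Gvq /eqP dq] := zq.
  have q_gt0 : 0 < dist G q z.
    rewrite lt0n; apply: contra npq => /eqP q0.
    have p0 : dist G p z = 0 by apply: succn_inj; rewrite dp -dq q0.
    by move/eqP: q0; move/eqP: p0; rewrite !dist_eq0 // => /eqP -> /eqP ->.
  have [c /andP[Gpc /eqP dc] /andP[Gqc _]] :=
    common_toward Gpq (succn_inj (etrans dp (esym dq))) q_gt0.
  exists c; split=> //; apply: (@dist_apart _ _ z); first by rewrite -dp -dc.
  have := dist_adj_le connG z Gvr; have := nzr; rewrite /toward Gvr /=.
  by move: dp dq dc; clear; lia.
have /andP[Gva _] := xa; have /andP[Gvb _] := yb.
have npa : p != a by apply: contraNneq nya => <-.
have npb : p != b by apply: contraNneq nxb => <-.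
have nab : a != b by apply: contraNneq nya => ->.
have Gpb := toward_clique yp yb npb.
have [c [Gpc Gac cv cb]] := step x a b xp xa nxb Gvb npa.
have [e [Gpe Gbe ev ea]] := step y b a yp yb nya Gva npb.
have Gca : G c a by rewrite adj_sym.
have Gav : G a v by rewrite adj_sym.
have [Gab|nGab] := boolP (G a b).
  by apply: (gem_free Gca Gab Gbe cb _ Gpc Gpe); rewrite apart_sym.
by apply: (gem_free Gca Gav Gvb cv _ Gpc Gpb); rewrite /apart nab nGab.
Qed.

(** The vertex [v0] only ensures that the graph is nonempty. *)
Theorem ptolemaic_helly (B : {set T}) (f : T -> nat) (v0 : T) :
    {in B &, forall x y, dist G x y <= f x + f y} ->
  exists v, {in B, forall x, dist G v x <= f x}.
Proof.
move=> meet.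
suff relax m k : m + k = #|T| ->
    exists v, {in B, forall x, dist G v x <= f x + k}.
  have [v vP] := relax _ _ (addn0 #|T|).
  by exists v => x /vP; rewrite addn0.
(* The violation k decreases from #|T|, which bounds every distance, to 0. *)
elim: m k => [|m IHm] k eqmk.
  exists v0 => x _; apply: leq_trans (dist_le_card G v0 x) _.
  by rewrite -eqmk leq_addl.
have [v vPk] := IHm k.+1 ltac:(lia).
pose far := [set x in B | dist G v x == f x + k.+1].
have [far0|[x1 far_x1]] := set_0Vmem far.
  exists v => x Bx; have : x \notin far by rewrite far0 inE.
  by rewrite inE Bx; have := vPk x Bx; lia.
pose C x := [set u | toward v x u].
case: (arg_minnP (fun x => #|C x|) far_x1) => x far_x minx.
have [Bx dx] : x \in B /\ dist G v x = f x + k.+1.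
  have : x \in far by [].
  by rewrite inE => /andP[? /eqP].
have sub y : y \in far -> C x \subset C y.
  move=> far_y; have := far_y; rewrite inE => /andP[By /eqP dy].
  have [p xp yp] : exists2 p, toward v x p & toward v y p.
    by apply: toward_meet; have := meet x y Bx By; lia.
  have [//|/subsetPn[a]] := boolP (C x \subset C y); rewrite !inE => xa nya.
  have: C y \proper C x.
    apply/properP; split; last by exists a; rewrite inE.
    apply/subsetP=> b; rewrite !inE => yb.
    by have := toward_nested xp yp xa yb; rewrite (negbTE nya).
  by move/proper_card; rewrite ltnNge minx.
have [u xu] : exists u, toward v x u by apply: exists_toward; lia.
exists u => y By; have /andP[Gvu _] := xu.
have leuvy : dist G u y <= (dist G v y).+1.
  by apply: dist_adj_le; rewrite // adj_sym.
have [far_y|] := boolP (y \in far).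
  have /subsetP/(_ u) := sub y far_y; rewrite !inE xu => /(_ isT) /andP[_].
  by have := vPk y By; lia.
rewrite inE By /= => ney; have := vPk y By.
have [eqy|] := eqVneq (dist G v y) (f y + k); last by lia.
have := toward_dist_le (y := y) xu; have := meet x y Bx By; lia.
Qed.
End Ptolemaic.

(** * The boundary determines the distances *)

Section Boundary.
Variables (T : finType) (H : sgraph T).
Hypothesis connH : connected_graph H.

(** Among the x with v on a geodesic from u to x, one farthest from u works: a
    neighbor farther from u would again be such an x. *)
Lemma extend_to_boundary u v :
  exists2 x, x \in boundary H & dist H u x = dist H u v + dist H v x.
Proof.
pose ext := [pred x | dist H u x == dist H u v + dist H v x].
have ext_v : ext v by rewrite /= distxx addn0.
case: (arg_maxnP (dist H u) ext_v) => x /eqP extx maxx; exists x => //.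
apply/bigcupP; exists u => //; rewrite inE.
apply/forallP=> w; apply/implyP=> Hxw.
have [ext_w|next] := boolP (ext w); first exact: maxx.
have := dist_triangle connH v u w; move: next => /=.
have : dist H x w = 1 by apply/eqP; rewrite dist_adj.
have := dist_triangle connH x v w.
lia.
Qed.
End Boundary.

Lemma enum_val_cast (T : finType) (A B : {set T}) (eqAB : A = B)
    (e : #|B| = #|A|) (i : 'I_#|B|) :
  enum_val (cast_ord e i) = enum_val i.
Proof. by move: e; rewrite eqAB => e; rewrite cast_ord_id. Qed.

Lemma boundary_dist_matrix_eq (T : finType) (G H : sgraph T)
    (eqB : boundary H = boundary G) :
    castmx (card_boundary_eq eqB, card_boundary_eq eqB)
      (boundary_dist_matrix H) = boundary_dist_matrix G ->
  {in boundary G &, forall x y, dist H x y = dist G x y}.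
Proof.
move=> /matrixP eqD x y Bx By.
have := eqD (enum_rank_in Bx x) (enum_rank_in Bx y).
by rewrite castmxE !mxE !enum_val_cast // !enum_rankK_in.
Qed.

Theorem theorem12 (n : nat) (G : sgraph 'I_n) :
  connected_graph G -> ptolemaic G -> BDM_graph G.
Proof.
move=> connG ptolG H eqB connH /boundary_dist_matrix_eq eqD.
have represent v : exists u,
    {in boundary G, forall x, dist G u x = dist H v x}.
  have meet : {in boundary G &, forall x y,
      dist G x y <= dist H v x + dist H v y}.
    move=> x y Bx By; rewrite -eqD // [dist H v x](dist_sym connH).
    exact: dist_triangle.
  have [u uP] := ptolemaic_helly connG ptolG v meet.
  exists u => x Bx; have := uP x Bx.
  (* The lower bound comes from a y making the constraint at x tight. *)
  have [y] := extend_to_boundary connH x v; rewrite eqB => By.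
  rewrite eqD // (dist_sym connH x v).
  have := uP y By; have := dist_triangle connG u x y.
  by rewrite (dist_sym connG x u); lia.
have [phi phiP] := fin_all_exists represent.
have phi_dist u v : dist G (phi u) (phi v) = dist H u v.
  apply/eqP; rewrite eqn_leq; apply/andP; split.
    have [x Bx] := extend_to_boundary connG (phi u) (phi v).
    rewrite (phiP u x Bx) (phiP v x Bx).
    by have := dist_triangle connH v u x; lia.
  have [x] := extend_to_boundary connH u v; rewrite eqB => Bx.
  rewrite -(phiP u x Bx) -(phiP v x Bx).
  by have := dist_triangle connG (phi v) (phi u) x; lia.
have phi_inj : injective phi.
  move=> u v /eqP; rewrite -(dist_eq0 connG) phi_dist (dist_eq0 connH).
  exact/eqP.
exists (invF phi_inj); first exact: injF_bij (can_inj (f_invF phi_inj)).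
move=> u v; rewrite -(dist_adj connH) -phi_dist !f_invF.
exact: dist_adj.
Qed.
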